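(* For every real number $a$ with $1\le a<2$, the graph of $\{\lfloor n^a\rfloor\}_{n=1}^\infty$ contains arbitrarily long arithmetic progressions.
   Context: $\mathbb{N}=\{1,2,\ldots\}$. For integers $k\ge3$, $d\ge1$, a sequence $\{p(j)\}_{j=0}^{k-1}\subset\mathbb{N}^d$ is an arithmetic progression (AP) of length $k$ if there is $D\in\mathbb{N}^d$ (so all components of $D$ are positive) with $p(j)=p(0)+jD$ for all $j=0,\ldots,k-1$. ''Contains arbitrarily long APs'' means: contains an AP of length $k$ for every $k\ge3$. The graph of a sequence $\{a(n)\}_{n=1}^\infty\subset\mathbb{N}$ is the set $\{(n,a(n))\in\mathbb{N}^2\mid n\in\mathbb{N}\}$. *)

(* Defs.v *)
From HB Require Import structures.
From mathcomp Require Import all_boot all_order all_algebra.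
From mathcomp Require Import all_classical all_reals all_analysis.

Set Implicit Arguments.
Unset Strict Implicit.
Unset Printing Implicit Defensive.

Import Order.TTheory GRing.Theory Num.Theory.

Local Open Scope classical_set_scope.
Local Open Scope ring_scope.

(* Here N = {1, 2, ...}: a point of N^d is a row vector of natural numbers
   all of whose entries are positive. *)
Definition positive_vec (d : nat) (x : 'rV[nat]_d) : Prop :=
  forall i : 'I_d, (0 < x ord0 i)%N.

(* Only the values p 0, ..., p (k - 1) of p are relevant. *)
Definition is_AP (k d : nat) (p : nat -> 'rV[nat]_d) : Prop :=
  (forall j : nat, (j < k)%N -> positive_vec (p j)) /\
  exists2 D : 'rV[nat]_d, positive_vec D &
    forall j : nat, (j < k)%N -> p j = p 0%N + D *+ j.

Definition contains_arbitrarily_long_APs (d : nat) (S : set 'rV[nat]_d) : Prop :=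
  forall k : nat, (3 <= k)%N ->
    exists2 p : nat -> 'rV[nat]_d, is_AP k p &
      forall j : nat, (j < k)%N -> S (p j).

Definition point2 (x y : nat) : 'rV[nat]_2 :=
  \row_(i < 2) (if i == ord0 then x else y).

(* Sequences are indexed from 1; the value of u at 0 is ignored. *)
Definition seq_graph (u : nat -> nat) : set 'rV[nat]_2 :=
  [set point2 n (u n) | n in [set n : nat | (0 < n)%N]].

(* For n >= 1 and a >= 0 the floor is positive, so that the absolute value
   is just the conversion from int to nat. *)
Definition floor_pow (R : realType) (a : R) (n : nat) : nat :=
  `|Num.floor ((n%:R : R) `^ a)|%N.

(* Main.v *)
Require Import Defs.
From HB Require Import structures.
From mathcomp Require Import all_boot all_order all_algebra.
From mathcomp Require Import all_classical all_reals all_analysis.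
From mathcomp Require Import ring lra zify.

Import Order.TTheory GRing.Theory Num.Theory.

Local Open Scope ring_scope.

(** The progression can be taken with step 1 in the abscissa.

    Write f n = n ^ a.  For 1 < a < 2 the slopes f (n + 1) - f n increase to
    infinity, while their own increments, of order n ^ (a - 2), tend to 0.
    So for a large integer H there is a first n0 at which the slope reaches H,
    and it then exceeds H only by a tiny amount.  The sequence
    g t = f (n0 + t) - t H is nondecreasing and starts almost horizontally, with
    slopes that grow very slowly.  It is nevertheless unbounded, so it crosses
    the next integer M above g 0.  When it does, its slope is still small:
    a slope s that has been built up slowly was preceded by many slopes
    of comparable size, and their sum would have carried g across M earlier.
    Just after the crossing, g therefore spends k consecutive steps inside
    [M, M + 1), and there floor (f (n0 + t)) = M + t H: the graph of floor f
    contains a progression of length k with difference (1, H).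

    The crossing argument is [slow_convex_seq_const_floor]; it is turned into a
    statement about slowly steepening sequences in [slow_convex_seq_floor_AP].
    The hypotheses on slopes of n ^ a come from the mean value theorem
    ([powR_mvt_bounds]) and from the bound [powR_add_le] on the increments of
    x ^ b for b <= 1.  For a = 1 the slopes are constant and the graph is
    the diagonal. *)

(** * Convex sequences with slowly growing slopes *)

Lemma convex_seq_slope_homo (R : realType) (g : nat -> R)
  (cvx : forall t, g t.+1 - g t <= g t.+2 - g t.+1) :
  {homo (fun t => g t.+1 - g t) : s t / (s <= t)%N >-> s <= t}.
Proof. by apply: homo_leq => // x y z; apply: le_trans. Qed.

Lemma convex_seq_slope_lipschitz (R : realType) (g : nat -> R) (eps : R)
  (small : forall t, g t.+2 - g t.+1 <= g t.+1 - g t + eps) t i :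
  g (t + i).+1 - g (t + i)%N <= g t.+1 - g t + i%:R * eps.
Proof.
elim: i => [|i IH]; first by rewrite addn0 mul0r addr0.
have := small (t + i)%N; rewrite addnS -natr1; lra.
Qed.

Lemma convex_seq_tangent (R : realType) (g : nat -> R)
  (cvx : forall t, g t.+1 - g t <= g t.+2 - g t.+1) t i :
  g t + i%:R * (g t.+1 - g t) <= g (t + i)%N.
Proof.
elim: i => [|i IH]; first by rewrite addn0 mul0r addr0.
have := convex_seq_slope_homo _ _ cvx t (t + i)%N (leq_addr _ _).
rewrite /= addnS -natr1; lra.
Qed.

Lemma convex_seq_upper (R : realType) (g : nat -> R)
  (cvx : forall t, g t.+1 - g t <= g t.+2 - g t.+1) t i :
  g (t + i)%N <= g t + i%:R * (g (t + i).+1 - g (t + i)%N).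
Proof.
elim: i => [|i IH]; first by rewrite addn0 mul0r addr0.
have h := cvx (t + i)%N.
have hi : i%:R * (g (t + i).+1 - g (t + i)%N)
    <= i%:R * (g (t + i).+2 - g (t + i).+1) by rewrite ler_wpM2l.
rewrite addnS -natr1; lra.
Qed.

(** The slope after k more steps is at most 1 / k at the last index S before the
    crossing.  If S <= 2k there has been no time to build up a larger slope
    from a start in [0, eps].  Otherwise the 2k steps that lead to S raise
    g by less than 1, so the slope 2k steps before S is below 1 / (2k), and
    2k + k further steps add at most 3k eps.  The bound on eps makes the added
    part at most 1 / (2k) in both cases. *)
Lemma slow_convex_seq_const_floor (R : realType) (k : nat) (eps : R)
  (g : nat -> R) (k0 : (0 < k)%N) (eps0 : 0 <= eps)
  (hk : (k * (6 * k + 2))%:R * eps <= 1)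
  (cvx : forall t, g t.+1 - g t <= g t.+2 - g t.+1)
  (small : forall t, g t.+2 - g t.+1 <= g t.+1 - g t + eps)
  (d0 : 0 <= g 1%N - g 0%N) (d0eps : g 1%N - g 0%N <= eps)
  (steep : exists t, 1 <= g t.+1 - g t) :
  exists S : nat, forall j, (j < k)%N ->
    Num.floor (g (S.+1 + j)%N) = Num.floor (g 0%N) + 1.
Proof.
have hom := convex_seq_slope_homo _ _ cvx.
have dge0 t : 0 <= g t.+1 - g t by apply: le_trans d0 _; exact: (hom 0%N).
have gmono : {homo g : s t / (s <= t)%N >-> s <= t}.
  apply: homo_leq => // [x y z|t]; [exact: le_trans | by rewrite -subr_ge0].
(* M is the least integer strictly above g 0, hence at most g 0 + 1. *)
set M : R := (Num.floor (g 0%N) + 1)%:~R.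
have ltM : g 0%N < M by exact: floorD1_gt.
have leM : M - 1 <= g 0%N.
  by rewrite /M intrD addrK; case/andP: (floor_itv (g 0%N)).
have exS : exists t, M <= g t.
  case: steep => t ht; exists t.+1; have := gmono 0%N t (leq0n _); lra.
case: (ex_minnP exS) => -[|S] MS minS; first lra.
have gS : g S < M.
  by rewrite ltNge; apply/negP => /minS; rewrite ltnn.
have kR : (0 : R) < k%:R by rewrite ltr0n.
have slope : k%:R * (g (S + k).+1 - g (S + k)%N) <= 1.
  have hk2 : k%:R * ((6 * k%:R + 2) * eps) <= 1.
    by move: hk; rewrite natrM natrD natrM mulrA.
  have [S2k|S2k] := leqP S (2 * k)%N.
    have := convex_seq_slope_lipschitz _ _ _ small 0%N (S + k)%N.
    rewrite add0n => h.
    have SR : (S + k)%:R * eps <= (3 * k%:R) * eps.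
      rewrite ler_wpM2r // -natrM ler_nat; lia.
    have : k%:R * (g (S + k).+1 - g (S + k)%N)
        <= k%:R * ((6 * k%:R + 2) * eps).
      apply: (ler_wpM2l (ltW kR)).
      have : 0 <= (3 * k%:R + 1) * eps by rewrite mulr_ge0 //; lra.
      lra.
    lra.
  pose r := (S - 2 * k)%N.
  have Sr : S = (r + 2 * k)%N by rewrite /r; lia.
  have := convex_seq_tangent _ _ cvx r (2 * k)%N.
  rewrite -Sr natrM => h1.
  have h2 := gmono 0%N r (leq0n _).
  have := convex_seq_slope_lipschitz _ _ _ small r (2 * k + k)%N.
  rewrite addnA -Sr => h3.
  have h4 : k%:R * (g (S + k).+1 - g (S + k)%N)
      <= k%:R * (g r.+1 - g r + (2 * k + k)%:R * eps).
    exact: (ler_wpM2l (ltW kR)).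
  have h5 : 0 <= k%:R * eps by exact: (mulr_ge0 (ltW kR) eps0).
  rewrite natrD natrM in h4; lra.
(* The k values after S lie at least at M, by the choice of S, and
   at most k slopes of size 1 / k above g S < M. *)
exists S => j jk; apply: floor_def; rewrite (intrD _ (_ + _)) -/M; apply/andP; split.
  exact: (le_trans MS (gmono _ _ (leq_addr _ _))).
have h1 := convex_seq_upper _ _ cvx S j.+1.
have h2 := hom (S + j.+1)%N (S + k)%N ltac:(lia); rewrite /= in h2.
have h3 := dge0 (S + k)%N.
have h4 : j.+1%:R * (g (S + j.+1).+1 - g (S + j.+1)%N)
   <= k%:R * (g (S + k).+1 - g (S + k)%N).
  by apply: ler_pM => //; rewrite ler_nat.
rewrite addSnnS; lra.
Qed.

(** Subtracting t H from u, where H is an integer that the slopes have just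
    passed, brings the slopes close to 0 and shifts floors by integers.  The
    integer H is taken above all slopes in the initial range where the slopes
    may still jump by more than eps, so that the slope at n0 overshoots H by at
    most eps. *)
Lemma slow_convex_seq_floor_AP (R : realType) (u : nat -> R) (k : nat)
  (cvx : forall n, u n.+1 - u n <= u n.+2 - u n.+1)
  (steep : forall A : R, exists n, A <= u n.+1 - u n)
  (flat : forall eps : R, 0 < eps -> exists N, forall n, (N <= n)%N ->
     u n.+2 - u n.+1 <= u n.+1 - u n + eps) :
  exists n H : nat, [/\ (0 < n)%N, (0 < H)%N &
    forall j, (j < k)%N -> Num.floor (u (n + j)%N) = Num.floor (u n) + (j * H)%:Z].
Proof.
case: k => [|k]; first by exists 1%N, 1%N.
(* The largest step allowed by the crossing lemma. *)
set k1 := k.+1; pose eps : R := (k1 * (6 * k1 + 2))%:R^-1.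
have eps0 : 0 < eps by rewrite invr_gt0 ltr0n muln_gt0 addn_gt0 orbT.
have [N hN] := flat _ eps0.
have hom := convex_seq_slope_homo _ _ cvx.
pose A := Num.max 0 (u N.+1 - u N).
have [A0 AN] : 0 <= A /\ u N.+1 - u N <= A by rewrite !le_max !lexx orbT.
pose H := Num.bound A.
have AH : A < H%:R := archi_boundP A0.
have [n0 Hn0 minn0] := ex_minnP (steep H%:R).
have Nn0 : (N < n0)%N.
  rewrite ltnNge; apply/negP => /hom /= h; lra.
have dn0 : u n0.+1 - u n0 <= H%:R + eps.
  case: n0 Nn0 Hn0 minn0 => // n0 Nn0 Hn0 minn0.
  have h := hN n0 Nn0.
  have : u n0.+1 - u n0 < H%:R.
    by rewrite ltNge; apply/negP => /minn0; rewrite ltnn.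
  lra.
pose g t := u (n0 + t)%N - (t * H)%:R.
have gS t : g t.+1 - g t = u (n0 + t).+1 - u (n0 + t)%N - H%:R.
  rewrite /g addnS mulSn natrD; ring.
have := @slow_convex_seq_const_floor R k1 eps g isT (ltW eps0).
case=> //.
- by rewrite mulfV // pnatr_eq0 muln_eq0 addn_eq0.
- by move=> t; rewrite !gS addnS lerB.
- move=> t; rewrite !gS addnS; have := hN (n0 + t)%N ltac:(lia); lra.
- by rewrite gS addn0 subr_ge0.
- rewrite gS addn0; lra.
- have [t ht] := steep (H%:R + 1).
  by exists t; rewrite gS; have := hom t (n0 + t)%N (leq_addl _ _); rewrite /=; lra.
move=> S hS; exists (n0 + S.+1)%N, H; split => //; first by rewrite addnS.
have uE j : (j < k1)%N ->
  Num.floor (u (n0 + S.+1 + j)%N) =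
    Num.floor (g 0%N) + 1 + ((S.+1 + j) * H)%:Z.
  move=> jk; rewrite -(hS j jk).
  have -> : u (n0 + S.+1 + j)%N = g (S.+1 + j)%N + ((S.+1 + j) * H)%:R.
    by rewrite /g subrK addnA.
  by rewrite pmulrn floorDrz ?intr_int // intrKfloor.
move=> j jk; have := uE 0%N isT; rewrite addn0 uE // => ->.
by rewrite !PoszM PoszD addn0; ring.
Qed.

(** * Slopes of power functions *)

Lemma powR_mvt_bounds (R : realType) (a x y : R) : 1 <= a -> 0 < x -> x < y ->
  a * x `^ (a - 1) * (y - x) <= y `^ a - x `^ a <= a * y `^ (a - 1) * (y - x).
Proof.
move=> a1 x0 xy.
have [|z zi|c] := @MVT R (fun z => z `^ a) (fun z => a * z `^ (a - 1)) x y xy.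
- move=> z; rewrite in_itv /= => /andP[xz _].
  by apply: is_derive1_powR; lra.
- apply: derivable_within_continuous => z'; rewrite in_itv /= => /andP[xz _].
  by apply: derivable_powR; rewrite in_itv /= andbT; lra.
rewrite in_itv /= => /andP[xc cy] ->.
have a10 : 0 <= a - 1 by lra.
have yx0 : 0 <= y - x by lra.
have a0 : 0 <= a by lra.
apply/andP; split; apply: ler_wpM2r => //; apply: ler_wpM2l => //;
  by apply: ge0_ler_powR; rewrite ?nnegrE //; lra.
Qed.

Lemma powR_eventually_ge (R : realType) (b A : R) : 0 < b ->
  exists N, forall n, (N <= n)%N -> A <= n%:R `^ b.
Proof.
move=> b0; pose B := (Num.max 0 A) `^ b^-1.
exists (Num.bound B) => n Nn.
have Bn : B <= n%:R.
  by apply: le_trans (ltW (archi_boundP (powR_ge0 _ _))) _; rewrite ler_nat.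
apply: (@le_trans _ _ (B `^ b)).
  rewrite /B -powRrM mulVf ?gt_eqF // powRr1 ?le_max ?lexx //.
  by rewrite orbT.
by apply: ge0_ler_powR; rewrite ?nnegrE ?powR_ge0 ?ler0n ?(ltW b0).
Qed.

(** After division by x ^ b this reads (1 + h / x) ^ b <= 1 + h / x, which holds
    because b <= 1; it bounds the increments of x ^ b without a second
    derivative. *)
Lemma powR_add_le (R : realType) (b x h : R) : 0 < b <= 1 -> 0 < x -> 0 <= h ->
  (x + h) `^ b <= x `^ b + h * x `^ (b - 1).
Proof.
move=> /andP[b0 b1] x0 h0.
have -> : x + h = x * (1 + h / x) by field; rewrite gt_eqF.
have hx : 0 <= h / x by rewrite divr_ge0 // ltW.
have x1 : x `^ b = x * x `^ (b - 1) by rewrite mulr_powRB1 // ltW.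
have -> : x `^ b + h * x `^ (b - 1) = x `^ b * (1 + h / x).
  by rewrite x1; field; rewrite gt_eqF.
rewrite powRM ?(ltW x0) ?addr_ge0 // ler_wpM2l ?powR_ge0 // ler1_powR //; lra.
Qed.

Lemma powR_slope_bounds (R : realType) (a : R) (n : nat) : 1 <= a ->
  a * n.+1%:R `^ (a - 1) <= n.+2%:R `^ a - n.+1%:R `^ a <= a * n.+2%:R `^ (a - 1).
Proof.
move=> a1; have := @powR_mvt_bounds R a n.+1%:R n.+2%:R a1.
have -> : n.+2%:R - n.+1%:R = 1 :> R by rewrite -(natr1 n.+1); ring.
by rewrite !mulr1; apply; rewrite ?ltr0n ?ltr_nat.
Qed.

(** The sequence is indexed as (n + 1) ^ a because the slope bounds need positive
    abscissas. *)
Lemma floor_powR_local_AP (R : realType) (a : R) (k : nat) : 1 < a -> a < 2 ->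
  exists n H : nat, [/\ (0 < n)%N, (0 < H)%N &
    forall j, (j < k)%N -> Num.floor ((n + j)%:R `^ a) =
      Num.floor ((n%:R : R) `^ a) + (j * H)%:Z].
Proof.
move=> a1 a2.
have bounds n := @powR_slope_bounds R a n (ltW a1).
have [||eps eps0|n [H [n0 H0 hH]]] :=
  @slow_convex_seq_floor_AP R (fun n => n.+1%:R `^ a) k.
- move=> n; have /andP[_ h1] := bounds n; have /andP[h2 _] := bounds n.+1.
  exact: le_trans h1 h2.
- move=> A; have [N hN] := @powR_eventually_ge R (a - 1) A ltac:(lra).
  exists N; have /andP[h _] := bounds N; apply: le_trans h.
  apply: le_trans (hN N.+1 (leqnSn _)) _.
  by rewrite ler_peMl ?powR_ge0 // ltW.
(* The second difference of (n + 1) ^ a is at most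
   a ((n + 3) ^ (a - 1) - (n + 1) ^ (a - 1)) <= 2 a (n + 1) ^ (a - 2). *)
- have [N hN] := @powR_eventually_ge R (2 - a) (2 * a / eps) ltac:(lra).
  exists N => n Nn; have /andP[h1 _] := bounds n; have /andP[_ h2] := bounds n.+1.
  have x0 : 0 < n.+1%:R :> R by rewrite ltr0n.
  have h3 : n.+3%:R `^ (a - 1) <= n.+1%:R `^ (a - 1) + 2 * n.+1%:R `^ (a - 2) :> R.
    have := @powR_add_le R (a - 1) n.+1%:R 2 ltac:(lra) x0 ltac:(lra).
    have -> : n.+1%:R + 2 = n.+3%:R :> R by rewrite -natrD addn2.
    by have -> : a - 1 - 1 = a - 2 by ring.
  have h4 : 2 * a * n.+1%:R `^ (a - 2) <= eps.
    have := hN n.+1 (leqW Nn).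
    have -> : a - 2 = - (2 - a) by ring.
    rewrite powRN ler_pdivrMr // => h.
    by rewrite ler_pdivrMr ?powR_gt0 // [eps * _]mulrC.
  have : a * n.+3%:R `^ (a - 1) <=
     a * (n.+1%:R `^ (a - 1) + 2 * n.+1%:R `^ (a - 2)).
    by apply: ler_wpM2l => //; lra.
  lra.
- by exists n.+1, H; split => // j jk; rewrite addSn hH.
Qed.

(** * Progressions in the graph *)

Lemma floor_powE (R : realType) (a : R) (n : nat) :
  ((floor_pow a n)%:Z = Num.floor ((n%:R : R) `^ a))%R.
Proof. by rewrite /floor_pow gez0_abs // floor_ge0 powR_ge0. Qed.

Lemma floor_pow_gt0 (R : realType) (a : R) (n : nat) :
  0 <= a -> (0 < n)%N -> (0 < floor_pow a n)%N.
Proof.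
move=> a0 n0; rewrite -ltz_nat floor_powE floor_gt0.
suff: 1 `^ a <= n%:R `^ a :> R by rewrite powR1.
by apply: ge0_ler_powR; rewrite ?nnegrE ?ler01 ?ler0n ?ler1n.
Qed.

Lemma graph_contains_APs (u : nat -> nat) :
  (forall n, (0 < n)%N -> (0 < u n)%N) ->
  (forall k, exists n H : nat, [/\ (0 < n)%N, (0 < H)%N &
     forall j, (j < k)%N -> u (n + j)%N = (u n + j * H)%N]) ->
  contains_arbitrarily_long_APs (seq_graph u).
Proof.
move=> u0 hu k k3; have [n [H [n0 H0 hH]]] := hu k.
exists (fun j => point2 (n + j) (u n + j * H)); last first.
  by move=> j jk; exists (n + j)%N; rewrite ?hH //= addn_gt0 n0.
split=> [j jk i|].
  by rewrite mxE; case: ifP; rewrite addn_gt0 ?n0 ?u0.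
exists (point2 1 H) => [i|j jk]; first by rewrite mxE; case: ifP.
apply/rowP => i; rewrite !mxE mulmxnE !mxE addn0 mul0n addn0.
by rewrite -mulr_natr natn; case: ifP => _; rewrite ?mul1r // mulrC.
Qed.

Theorem corollary1p6 (R : realType) (a : R) (ha1 : 1 <= a) (ha2 : a < 2) :
  contains_arbitrarily_long_APs (seq_graph (floor_pow a)).
Proof.
apply: graph_contains_APs => [n|k]; first by apply: floor_pow_gt0; lra.
have [a1|a1] := eqVneq a 1.
  exists 1%N, 1%N; split => // j _.
  suff fE n : floor_pow a n = n by rewrite !fE muln1.
  by apply/eqP; rewrite -eqz_nat floor_powE a1 powRr1 // pmulrn intrKfloor.
have [|n [H [n0 H0 hH]]] := @floor_powR_local_AP R a k _ ha2.
  by rewrite lt_neqAle eq_sym a1.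
exists n, H; split => // j jk; apply/eqP.
by rewrite -eqz_nat PoszD !floor_powE hH.
Qed.
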